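(* Let $\Phi$ be any positive, trace-preserving linear map on the hermitian $2\times2$ matrices, written as $$\Phi\big(\tfrac12(x_0I+\vec x\cdot\vec\sigma)\big)=\tfrac12\big(x_0 I+(x_0\vec t+\Lambda\vec x)\cdot\vec\sigma\big)$$ for some real $3\times3$ matrix $\Lambda$ and some $\vec t\in\mathbb{R}^3$. For $w\in\mathbb{R}$ consider the quadratic form $$q^\Phi_w(\mathbf{x})=\Phi(\mathbf{x})\cdot\Phi(\mathbf{x})-w\,\mathbf{x}\cdot\mathbf{x}.$$ Its matrix is $$Q^\Phi_w=\begin{pmatrix}1-|\vec t|^2-w & -\vec t^{\,T}\Lambda\\ -(\vec t^{\,T}\Lambda)^T & w I_3-\Lambda^T\Lambda\end{pmatrix}.$$ Then there exists a unique $w_0\in\mathbb{R}$ with the following three properties: - $Q^\Phi_{w_0}$ is positive semidefinite; - $Q^\Phi_{w_0}$ is degenerate; - $\ker Q^\Phi_{w_0}$ contains a non-zero vector $\mathbf{n}$ with $\mathbf{n}\cdot\mathbf{n}\le 0$. For this $w_0$, the concurrence of $\Phi$ satisfies $C_\Phi(\rho)=\sqrt{q^\Phi_{w_0}(\mathbf{x})}$ for every state $\rho=\tfrac12(I+\vec x\cdot\vec\sigma)$, where $\mathbf{x}=(1,\vec x)$.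
   Context: Hermitian $2\times2$ matrices are identified with Minkowski space $\mathbb{R}^{1,3}$ via $\mathbf{x}=(x_0,\vec x)\leftrightarrow\rho=\tfrac12(x_0I+\vec x\cdot\vec\sigma)$, where $\vec\sigma$ are the Pauli matrices. The Minkowski product is $\mathbf{x}\cdot\mathbf{y}=x_0y_0-\vec x\cdot\vec y$, so that $4\det\rho=\mathbf{x}\cdot\mathbf{x}$. We write $\Phi(\mathbf{x})$ for the vector corresponding to $\Phi(\rho)$. For a positive trace-preserving map $\Phi$ into $2\times 2$ matrices, the concurrence is defined as follows. For a pure state $\pi$, $C_\Phi(\pi)=2\sqrt{\det\Phi(\pi)}$. For a general state, $$C_\Phi(\rho)=\min\sum_j p_j C_\Phi(\pi_j),$$ where the minimum is over all decompositions $\rho=\sum_j p_j\pi_j$ into pure states with $p_j>0$ and $\sum p_j=1$. *)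

(* Defs.v *)
From HB Require Import structures.
From mathcomp Require Import all_boot all_order all_algebra.
Set Implicit Arguments. Unset Strict Implicit. Unset Printing Implicit Defensive.
Import Order.TTheory GRing.Theory Num.Theory.
Local Open Scope ring_scope.

(* Minkowski vectors x = (x_0, \vec x) as column vectors of size 1+3;
   x <-> rho = 1/2 (x_0 I + \vec x . \vec sigma). *)
Notation mvec R := ('cV[R]_(1 + 3)).

Definition x0 {R : rcfType} (x : mvec R) : R := usubmx x ord0 ord0.
Definition xv {R : rcfType} (x : mvec R) : 'cV[R]_3 := dsubmx x.

Definition minkJ {R : rcfType} : 'M[R]_(1 + 3) := block_mx 1 0 0 (- 1).
Definition mdot {R : rcfType} (x y : mvec R) : R := (x^T *m minkJ *m y) ord0 ord0.

Definition Phi {R : rcfType} (L : 'M[R]_3) (t : 'cV[R]_3) (x : mvec R) : mvec R :=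
  col_mx (usubmx x) (x0 x *: t + L *m xv x).

(* rho = 1/2(x_0 I + \vec x.\vec sigma) is positive semidefinite iff
   tr rho >= 0 and det rho >= 0, i.e. x_0 >= 0 and x.x = 4 det rho >= 0. *)
Definition psd_herm {R : rcfType} (x : mvec R) : Prop := 0 <= x0 x /\ 0 <= mdot x x.

(* Phi is positive: maps positive semidefinite matrices to positive semidefinite ones
   (trace preservation is built in: the x_0 component is preserved). *)
Definition positive_map {R : rcfType} (L : 'M[R]_3) (t : 'cV[R]_3) : Prop :=
  forall x : mvec R, psd_herm x -> psd_herm (Phi L t x).

(* states: psd with trace 1 (x_0 = 1); pure states: additionally det = 0 (rank one) *)
Definition is_state {R : rcfType} (x : mvec R) : Prop := psd_herm x /\ x0 x = 1.
Definition is_pure {R : rcfType} (x : mvec R) : Prop := is_state x /\ mdot x x = 0.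

(* det of the matrix corresponding to x: 4 det rho = x.x *)
Definition det_of {R : rcfType} (x : mvec R) : R := mdot x x / 4%:R.

Definition conc_pure {R : rcfType} (L : 'M[R]_3) (t : 'cV[R]_3) (x : mvec R) : R :=
  2%:R * Num.sqrt (det_of (Phi L t x)).

Definition pure_decomp {R : rcfType} (x : mvec R) (n : nat)
    (p : 'I_n -> R) (pi : 'I_n -> mvec R) : Prop :=
  (forall j, 0 < p j) /\ \sum_(j < n) p j = 1 /\ (forall j, is_pure (pi j)) /\
  \sum_(j < n) p j *: pi j = x.

Definition decomp_value {R : rcfType} (L : 'M[R]_3) (t : 'cV[R]_3) (n : nat)
    (p : 'I_n -> R) (pi : 'I_n -> mvec R) : R :=
  \sum_(j < n) p j * conc_pure L t (pi j).

Definition concurrence_is {R : rcfType} (L : 'M[R]_3) (t : 'cV[R]_3) (x : mvec R)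
    (c : R) : Prop :=
  (exists n p pi, @pure_decomp R x n p pi /\ decomp_value L t p pi = c) /\
  (forall n p pi, @pure_decomp R x n p pi -> c <= decomp_value L t p pi).

Definition qform {R : rcfType} (L : 'M[R]_3) (t : 'cV[R]_3) (w : R) (x : mvec R) : R :=
  mdot (Phi L t x) (Phi L t x) - w * mdot x x.

Definition Qmat {R : rcfType} (L : 'M[R]_3) (t : 'cV[R]_3) (w : R) : 'M[R]_(1 + 3) :=
  block_mx ((1 - (t^T *m t) ord0 ord0 - w)%:M) (- (t^T *m L))
           (- (t^T *m L)^T) (w%:M - L^T *m L).

Definition psd_mx {R : rcfType} (Q : 'M[R]_(1 + 3)) : Prop :=
  forall v : mvec R, 0 <= (v^T *m Q *m v) ord0 ord0.

Definition good_w {R : rcfType} (L : 'M[R]_3) (t : 'cV[R]_3) (w : R) : Prop :=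
  psd_mx (Qmat L t w) /\ \det (Qmat L t w) = 0 /\
  exists n : mvec R, n != 0 /\ Qmat L t w *m n = 0 /\ mdot n n <= 0.

(* Main.v *)
Require Import Defs.
From HB Require Import structures.
From mathcomp Require Import all_boot all_order all_algebra.
From mathcomp Require Import spectral complex.
From mathcomp Require Import ring lra.
Set Implicit Arguments. Unset Strict Implicit. Unset Printing Implicit Defensive.
Import Order.TTheory GRing.Theory Num.Theory.
Local Open Scope ring_scope.

(* Diagonalising [L^T L] turns [q_w] into
     (c - w) s^2 - 2 s (b . y) + sum_i (w - d_i) y_i^2,
   and positivity of [Phi] says that [q_w (1, y) >= 0] on the unit sphere.  For
   [w > max d] the form is minimal in [y] at [y = s z(w)], [z_i = b_i / (w - d_i)],
   hence semidefinite iff [g w := q_w (1, z(w)) >= 0].  Where [|z(w)| = 1] this holds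
   by positivity; going down from there one reaches either a zero [w0] of [g], where
   [n = (1, z(w0))] is in the kernel and [|z(w0)| >= 1] because [|z|] decreases, or
   the end point [max d], where an eigenvector of [L^T L] gives a spacelike [n].

   As [sqrt q_w0] is a seminorm agreeing with the concurrence on pure states, it is a
   lower bound.  It is constant along the direction [n], and since [n] is not
   timelike, the line through a mixed state in direction [n] decomposes the state
   into two null vectors, for which the bound is attained. *)

(** * Symmetric matrices *)

Definition cdot {R : rcfType} {n} (u v : 'cV[R]_n) : R := (u^T *m v) 0 0.

Lemma cdotE (R : rcfType) n (u v : 'cV[R]_n) : cdot u v = \sum_i u i 0 * v i 0.
Proof. by rewrite /cdot mxE; apply: eq_bigr => i _; rewrite mxE. Qed.

Lemma cdotC (R : rcfType) n (u v : 'cV[R]_n) : cdot u v = cdot v u.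
Proof. by rewrite !cdotE; apply: eq_bigr => i _; rewrite mulrC. Qed.

Lemma cdotDl (R : rcfType) n (u v w : 'cV[R]_n) :
  cdot (u + v) w = cdot u w + cdot v w.
Proof. by rewrite /cdot [(_ + _)^T]linearD/= mulmxDl mxE. Qed.

Lemma cdotDr (R : rcfType) n (u v w : 'cV[R]_n) :
  cdot u (v + w) = cdot u v + cdot u w.
Proof. by rewrite /cdot mulmxDr mxE. Qed.

Lemma cdotZl (R : rcfType) n (a : R) (u v : 'cV[R]_n) : cdot (a *: u) v = a * cdot u v.
Proof. by rewrite /cdot [(_ *: _)^T]linearZ/= -scalemxAl mxE. Qed.

Lemma cdotZr (R : rcfType) n (a : R) (u v : 'cV[R]_n) : cdot u (a *: v) = a * cdot u v.
Proof. by rewrite /cdot -scalemxAr mxE. Qed.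

Lemma cdot0r (R : rcfType) n (u : 'cV[R]_n) : cdot u 0 = 0.
Proof. by rewrite /cdot mulmx0 mxE. Qed.

Lemma cdot_mulmxl (R : rcfType) m n (A : 'M[R]_(m, n)) (u : 'cV[R]_n) (v : 'cV[R]_m) :
  cdot (A *m u) v = cdot u (A^T *m v).
Proof. by rewrite /cdot trmx_mul mulmxA. Qed.

Lemma cdot_sqr (R : rcfType) n (u : 'cV[R]_n) : cdot u u = \sum_i u i 0 ^+ 2.
Proof. by rewrite cdotE. Qed.

Lemma cdot_ge0 (R : rcfType) n (v : 'cV[R]_n) : 0 <= cdot v v.
Proof. by rewrite cdot_sqr sumr_ge0// => i _; exact: sqr_ge0. Qed.

Lemma cdot_eq0 (R : rcfType) n (v : 'cV[R]_n) : (cdot v v == 0) = (v == 0).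
Proof.
apply/idP/eqP => [|->]; last by rewrite cdot0r.
rewrite cdot_sqr psumr_eq0 => [/allP v0|i _]; last exact: sqr_ge0.
apply/colP => i; have := v0 i (mem_index_enum i).
by rewrite mxE sqrf_eq0 => /eqP.
Qed.

(** Over the algebraically closed field [R[i]] an eigenvalue [l] exists. Symmetry makes it real, and
    then the real or the imaginary part of its eigenvector serves. *)
Lemma symmetric_eigenvector (R : rcfType) n (A : 'M[R]_n.+1) : A^T = A ->
  exists a (v : 'cV[R]_n.+1), A *m v = a *: v /\ v != 0.
Proof.
move=> symA; pose A' : 'M[R[i]]_n.+1 := map_mx (real_complex R) A.
have [l /eigenvalueP[v vA v0]] := eigenvalue_closed A' (ltn0Sn n).
pose x := (map_mx (@complex.Re R) v)^T; pose y := (map_mx (@complex.Im R) v)^T.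
have vE i : (v *m A') 0 i = (((A *m x) i 0) +i* ((A *m y) i 0))%C.
  rewrite !mxE.
  transitivity (\sum_j (v 0 j * A' j i)); first by [].
  rewrite (eq_bigr (fun j => ((A i j * x j 0) +i* (A i j * y j 0))%C)); last first.
    move=> j _; rewrite !mxE -{1}symA mxE; case: (v 0 j) => s t /=.
    by apply/eqP; rewrite eq_complex/= !mulr0 subr0 add0r ![A i j * _]mulrC !eqxx.
  elim/big_rec3: _ => //= j p q _ _ ->; by [].
have Ax : A *m x = complex.Re l *: x - complex.Im l *: y.
  apply/colP => i; have := vE i; rewrite vA => /(congr1 (@complex.Re R)) /= <-.
  by rewrite !mxE; case: l {vA} => l1 l2; case: (v 0 i).
have Ay : A *m y = complex.Im l *: x + complex.Re l *: y.
  apply/colP => i; have := vE i; rewrite vA => /(congr1 (@complex.Im R)) /= <-.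
  by rewrite !mxE; case: l {vA Ax} => l1 l2; case: (v 0 i) => s t /=; ring.
(* The identity [(A x).y = x.(A y)] reads [Im l * (|x|^2 + |y|^2) = 0], and [x], [y] are not both
   zero. *)
have l0 : complex.Im l = 0.
  have: cdot (A *m x) y = cdot x (A *m y) by rewrite cdot_mulmxl symA.
  rewrite Ax Ay cdotDl cdotDr -scaleNr !cdotZl !cdotZr => h.
  have {}h : complex.Im l * (cdot x x + cdot y y) = 0 by lra.
  move/eqP: h; rewrite mulf_eq0 => /orP[/eqP//|].
  rewrite paddr_eq0 ?cdot_ge0// !cdot_eq0 => /andP[/eqP x0 /eqP y0].
  case/eqP: v0; apply/rowP => i; rewrite mxE.
  have /colP/(_ i) := x0; have /colP/(_ i) := y0; rewrite !mxE.
  by case: (v 0 i) => /= ? ? -> ->.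
have [x0|x0] := eqVneq x 0; last first.
  by exists (complex.Re l), x; rewrite Ax l0 scale0r subr0.
exists (complex.Re l), y; rewrite Ay l0 scale0r add0r; split=> //.
apply: contra v0 => /eqP y0; apply/eqP/rowP => i; rewrite mxE.
have /colP/(_ i) := x0; have /colP/(_ i) := y0; rewrite !mxE.
by case: (v 0 i) => /= ? ? -> ->.
Qed.

(** The reflection [1 - 2 u u^T / |u|^2] with [u = v - e] exchanges the unit vectors [e] and [v]. *)
Lemma householder (R : rcfType) n (v : 'cV[R]_n.+1) : cdot v v = 1 ->
  exists H : 'M[R]_n.+1, [/\ H^T = H, H *m H = 1%:M & H *m delta_mx 0 0 = v].
Proof.
move=> v1; pose e : 'cV[R]_n.+1 := delta_mx 0 0.
have [ve|ve] := eqVneq v e.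
  by exists 1%:M; rewrite trmx1 mulmx1 mul1mx ve.
pose u := v - e; pose s := cdot u u.
have s0 : s != 0 by rewrite /s cdot_eq0 subr_eq0.
have eTe : e^T *m e = 1%:M by rewrite trmx_delta mul_delta_mx;
  apply/matrixP => i j; rewrite !mxE !ord1.
have vTv : v^T *m v = 1%:M by rewrite [LHS]mx11_scalar -/(cdot v v) v1.
have vTe : e^T *m v = v^T *m e.
  by apply/matrixP => i j; rewrite !ord1 !mxE; apply: eq_bigr => k _; rewrite !mxE mulrC.
have uTu : u^T *m u = s%:M by rewrite [LHS]mx11_scalar.
(* Since [e] and [v] have length one, [|u|^2 = 2 - 2 v.e = -2 u.e]. *)
have uTe : u^T *m e = (- (s / 2))%:M.
  apply/matrixP => i j; rewrite !ord1.
  have : (u^T *m u) 0 0 = s by [].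
  rewrite /u [(_ - _)^T]linearB/= !mulmxBl !mulmxBr eTe vTv vTe.
  rewrite !mxE /= !mulr1n => h.
  have -> : s = 2 - 2 * (\sum_j v^T 0 j * e j 0) by rewrite -h; ring.
  by field.
exists (1%:M - (2 / s) *: (u *m u^T)); split.
- by rewrite linearB/= linearZ/= trmx_mul trmxK trmx1.
- rewrite mulmxBl mul1mx mulmxBr mulmx1 -scalemxAl -scalemxAr mulmxA -(mulmxA u) uTu.
  rewrite mul_mx_scalar -scalemxAl; move: (u *m u^T) => U.
  by apply/matrixP => i j; rewrite !mxE; field.
- rewrite mulmxBl mul1mx -scalemxAl -mulmxA uTe mul_mx_scalar scalerA.
  have -> : 2 / s * - (s / 2) = -1 :> R by field.
  by rewrite scaleN1r opprK /u addrC subrK.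
Qed.

(** Deflation: conjugating by a reflection that takes the first basis vector to a unit eigenvector
    clears the first column, hence by symmetry the first row, and induction treats the remaining
    block. *)
Lemma symmetric_diagonalization (R : rcfType) n (A : 'M[R]_n) : A^T = A ->
  exists (O : 'M[R]_n) (d : 'rV[R]_n), O^T *m O = 1%:M /\ O^T *m A *m O = diag_mx d.
Proof.
elim: n A => [|n IHn] A symA.
  by exists 1%:M, 0; split; apply/matrixP => -[].
have [a [v [Av v0]]] := symmetric_eigenvector symA.
have vv0 : 0 < cdot v v by rewrite lt_def cdot_eq0 v0 cdot_ge0.
pose r := Num.sqrt (cdot v v).
have r0 : r != 0 by rewrite sqrtr_eq0 -ltNge.
have [|H [HT HH He]] := @householder R n (r^-1 *: v).
  rewrite cdotZl cdotZr mulrA -expr2 exprVn.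
  by rewrite sqr_sqrtr ?ltW// mulVf// gt_eqF.
have [B Bdef] : exists B : 'M[R]_(1 + n), B = H *m A *m H by eexists.
have BT : B^T = B by rewrite Bdef !trmx_mul HT symA mulmxA.
have Be : B *m delta_mx 0 0 = a *: (delta_mx 0 0 : 'cV_n.+1).
  rewrite Bdef -!mulmxA He -scalemxAr Av scalerA mulrC -scalerA -He -scalemxAr.
  by rewrite mulmxA HH mul1mx.
have Bcol i : B i 0 = a * (i == 0)%:R.
  have := congr1 (fun M : 'cV_n.+1 => M i 0) Be.
  by rewrite -colE !mxE eqxx andbT.
have {}Bcol i : B i (lshift n 0) = a * (i == lshift n 0)%:R.
  by have -> : lshift n (0 : 'I_1) = (0 : 'I_n.+1); [exact: val_inj | exact: Bcol].
have BE : B = block_mx a%:M 0 0 (drsubmx B).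
  rewrite -[LHS]submxK; congr block_mx; apply/matrixP => i j; rewrite !mxE ?ord1.
  - by rewrite Bcol eqxx mulr1.
  - have -> : B (lshift n 0) (rshift 1 j) = B^T (rshift 1 j) (lshift n 0) by rewrite mxE.
    by rewrite BT Bcol mulr0.
  - by rewrite Bcol mulr0.
have [|P [d [PP PBP]]] := IHn (drsubmx B).
  by rewrite trmx_drsub BT.
pose P' : 'M[R]_(1 + n) := block_mx 1%:M 0 0 P.
have P'T : P'^T = block_mx 1%:M 0 0 P^T by rewrite tr_block_mx trmx1 !trmx0.
have P'P' : P'^T *m P' = 1%:M.
  rewrite P'T mulmx_block !mulmx0 !mul0mx mulmx1 !addr0 add0r PP.
  by rewrite -scalar_mx_block.
have P'BP' : P'^T *m B *m P' = diag_mx (row_mx a%:M d).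
  rewrite BE P'T !mulmx_block !(mulmx0, mul0mx) mulmx1 mul1mx !(addr0, add0r) PBP.
  rewrite diag_mx_row; congr block_mx; [|by rewrite mul0mx|by rewrite mul0mx].
  by apply/matrixP => i j; rewrite !ord1 !mxE.
exists (H *m P'), (row_mx a%:M d); split.
  by rewrite trmx_mul HT mulmxA -(mulmxA _ H H) HH mulmx1.
by rewrite trmx_mul HT !mulmxA -(mulmxA _ H A) -(mulmxA _ (H *m A) H) -Bdef.
Qed.

(** * The secular equation *)

(** Over an arbitrary real closed field continuity does not yield intermediate values, but
    polynomials have them; a positive denominator carries this over to quotients. *)
Definition rational_on {R : rcfType} (a b : R) (f : R -> R) : Prop :=
  exists p q : {poly R}, forall w, a <= w <= b -> 0 < q.[w] /\ f w = p.[w] / q.[w].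

Lemma rational_on_poly (R : rcfType) (a b : R) (p : {poly R}) :
  rational_on a b (fun w => p.[w]).
Proof. by exists p, 1 => w _; rewrite hornerC divr1. Qed.

Lemma rational_onD (R : rcfType) (a b : R) (f g : R -> R) :
  rational_on a b f -> rational_on a b g -> rational_on a b (fun w => f w + g w).
Proof.
move=> [p [q pq]] [r [s rs]]; exists (p * s + r * q), (q * s) => w wab.
have [q0 ->] := pq w wab; have [s0 ->] := rs w wab.
rewrite !hornerE; split; first exact: mulr_gt0.
by field; rewrite !gt_eqF.
Qed.

Lemma rational_onM (R : rcfType) (a b : R) (f g : R -> R) :
  rational_on a b f -> rational_on a b g -> rational_on a b (fun w => f w * g w).
Proof.
move=> [p [q pq]] [r [s rs]]; exists (p * r), (q * s) => w wab.
have [q0 ->] := pq w wab; have [s0 ->] := rs w wab.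
rewrite !hornerM; split; first exact: mulr_gt0.
by field; rewrite !gt_eqF.
Qed.

Lemma rational_on_sum (R : rcfType) (a b : R) n (F : 'I_n -> R -> R) :
  (forall i, rational_on a b (F i)) -> rational_on a b (fun w => \sum_(i < n) F i w).
Proof.
elim: n F => [|n IHn] F rF.
  by exists 0, 1 => w _; rewrite big_ord0 horner0 mul0r hornerC; split.
have [p [q pq]] := rational_onD (rF ord0) (IHn _ (fun i => rF (lift ord0 i))).
by exists p, q => w wab; rewrite big_ord_recl; exact: pq.
Qed.

Lemma rational_on_ivt (R : rcfType) (a b : R) (f : R -> R) :
  rational_on a b f -> a <= b -> f a <= 0 -> 0 <= f b ->
  exists2 w, a <= w <= b & f w = 0.
Proof.
move=> [p [q pq]] ab fa fb.
have [qa ea] := pq a ltac:(by rewrite lexx).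
have [qb eb] := pq b ltac:(by rewrite lexx andbT).
have [|w wab /rootP pw0] := @poly_ivt R p a b ab.
  by move: fa fb; rewrite ea eb pmulr_lle0 ?pmulr_lge0 ?invr_gt0// => -> ->.
by exists w => //; have [_ ->] := pq w wab; rewrite pw0 mul0r.
Qed.

(** This is [q_w (s, O y)] for an orthonormal eigenbasis [O] of [L^T L], with [c = 1 - |t|^2],
    [b = O^T L^T t] and [d] the eigenvalues. *)
Definition diag_form {R : rcfType} n (c : R) (b d : 'I_n -> R) (w s : R)
    (y : 'I_n -> R) : R :=
  (c - w) * s ^+ 2 - 2 * s * (\sum_i b i * y i) + \sum_i (w - d i) * y i ^+ 2.

(* At a pole [w = d i] this is [b i / 0 = 0], the value needed there as soon as
   [b i = 0]; [secular_dom] excludes the other poles. *)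
Definition secular_pt {R : rcfType} n (b d : 'I_n -> R) (w : R) (i : 'I_n) : R :=
  b i / (w - d i).

Definition secular_dom {R : rcfType} n (b d : 'I_n -> R) (w : R) : Prop :=
  forall i, d i <= w /\ (b i != 0 -> d i < w).

Section SecularEquation.
Variables (R : rcfType) (n : nat) (c : R) (b d : 'I_n -> R).

Local Notation q := (diag_form c b d).
Local Notation z := (secular_pt b d).
Local Notation regular := (secular_dom b d).

Lemma secular_ptE w i : regular w -> b i = (w - d i) * z w i.
Proof.
move=> /(_ i)[_ reg]; rewrite /secular_pt; have [->|/reg dw] := eqVneq (b i) 0.
  by rewrite mul0r mulr0.
by rewrite mulrC mulfVK// subr_eq0 gt_eqF.
Qed.

Lemma secular_domW a w : regular a -> a <= w -> regular w.
Proof.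
move=> reg aw i; have [da ba] := reg i; split; first exact: le_trans aw.
by move=> /ba /lt_le_trans; apply.
Qed.

(** Completing the squares in [y] around the stationary point [s z(w)]. *)
Lemma diag_form_secular w : regular w ->
  forall s y, q w s y = q w 1 (z w) * s ^+ 2 + \sum_i (w - d i) * (y i - s * z w i) ^+ 2.
Proof.
move=> reg s y; rewrite /diag_form.
have bE (x : 'I_n -> R) : \sum_i b i * x i = \sum_i (w - d i) * z w i * x i.
  by apply: eq_bigr => i _; rewrite -secular_ptE.
rewrite !bE.
have -> : \sum_i (w - d i) * (y i - s * z w i) ^+ 2 =
  \sum_i (w - d i) * y i ^+ 2 - 2 * s * (\sum_i (w - d i) * z w i * y i)
  + s ^+ 2 * (\sum_i (w - d i) * z w i * z w i).
  rewrite !mulr_sumr -sumrB -big_split/=; apply: eq_bigr => i _; ring.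
have -> : \sum_i (w - d i) * z w i ^+ 2 = \sum_i (w - d i) * z w i * z w i.
  by apply: eq_bigr => i _; ring.
ring.
Qed.

Lemma diag_form_secular_val w : regular w ->
  q w 1 (z w) = c - w - \sum_i b i * z w i.
Proof.
move=> reg; rewrite /diag_form.
have -> : \sum_i (w - d i) * z w i ^+ 2 = \sum_i b i * z w i.
  by apply: eq_bigr => i _; rewrite [b i in RHS](secular_ptE i reg); ring.
ring.
Qed.

Lemma diag_form_psd w : regular w -> 0 <= q w 1 (z w) -> forall s y, 0 <= q w s y.
Proof.
move=> reg q0 s y; rewrite diag_form_secular//.
apply: addr_ge0; first by rewrite mulr_ge0 ?sqr_ge0.
apply: sumr_ge0 => i _; have [di _] := reg i.
by rewrite mulr_ge0 ?sqr_ge0// subr_ge0.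
Qed.

Lemma rational_on_secular_pt a a' i : regular a -> rational_on a a' (z ^~ i).
Proof.
move=> /(_ i)[_ reg]; rewrite /secular_pt; have [b0|/reg da] := eqVneq (b i) 0.
  by exists 0, 1 => w _; rewrite horner0 b0 !mul0r hornerC; split.
exists (b i)%:P, ('X - (d i)%:P) => w /andP[aw _]; rewrite !hornerE; split=> //.
by rewrite subr_gt0 (lt_le_trans da).
Qed.

Lemma secular_norm_anti a w : regular a -> a <= w ->
  \sum_i z w i ^+ 2 <= \sum_i z a i ^+ 2.
Proof.
move=> reg aw; apply: ler_sum => i _; rewrite /secular_pt.
have [->|/(reg i).2 da] := eqVneq (b i) 0; first by rewrite !mul0r.
have dw := lt_le_trans da aw.
have a0 : 0 < a - d i by rewrite subr_gt0.
have w0 : 0 < w - d i by rewrite subr_gt0.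
rewrite !exprMn; apply: ler_wpM2l; first exact: sqr_ge0.
rewrite ler_sqr ?nnegrE ?invr_ge0; [|exact: ltW|exact: ltW].
by rewrite lef_pV2 ?posrE// lerD2r.
Qed.

(** At [w = a + (1 + B)] with [B = |b|^2] every [w - d i] is at least [1 + B >= 1], so the sum is at
    most [B / (1 + B)]. *)
Lemma secular_norm_lt1 a : regular a -> exists2 w, a <= w & \sum_i z w i ^+ 2 < 1.
Proof.
move=> reg; pose B := \sum_i b i ^+ 2.
have B0 : 0 <= B by apply: sumr_ge0 => i _; exact: sqr_ge0.
have B1 : 0 < 1 + B by rewrite ltr_pwDl.
exists (a + (1 + B)); first by rewrite lerDl ltW.
suff h : \sum_i z (a + (1 + B)) i ^+ 2 <= B / (1 + B).
  by apply: le_lt_trans h _; rewrite ltr_pdivrMr// mul1r ltrDr ltr01.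
rewrite /B mulr_suml -/B; apply: ler_sum => i _; rewrite /secular_pt.
have := (reg i).1; move=> da.
have h : 1 + B <= a + (1 + B) - d i by lra.
have h0 : 0 < a + (1 + B) - d i by apply: lt_le_trans h.
rewrite exprMn ler_wpM2l ?sqr_ge0// exprVn lef_pV2 ?posrE ?exprn_gt0//.
by nra.
Qed.

Hypothesis sphere_ge0 : forall y : 'I_n -> R, \sum_i y i ^+ 2 = 1 -> 
  0 <= c - 2 * (\sum_i b i * y i) - \sum_i d i * y i ^+ 2.

(** The terms in [w] cancel on the unit sphere, where [(1, y)] is lightlike. *)
Lemma diag_form_sphere w y : \sum_i y i ^+ 2 = 1 -> 0 <= q w 1 y.
Proof.
move=> y1; have := sphere_ge0 y1; rewrite /diag_form.
have -> : \sum_i (w - d i) * y i ^+ 2 = w * (\sum_i y i ^+ 2) - \sum_i d i * y i ^+ 2.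
  by rewrite mulr_sumr -sumrB; apply: eq_bigr => i _; ring.
rewrite y1 => h; lra.
Qed.

(** A first intermediate value gives [v] with [|z(v)| = 1], where the sphere condition makes the
    secular function nonnegative. A second one on [[a, v]] gives its zero [w], and [w <= v] keeps
    [|z(w)| >= 1]. *)
Lemma secular_root a : regular a -> 1 <= \sum_i z a i ^+ 2 -> q a 1 (z a) <= 0 ->
  exists2 w, regular w & q w 1 (z w) = 0 /\ 1 <= \sum_i z w i ^+ 2.
Proof.
move=> reg phi1 qa.
have [M aM phiM] := secular_norm_lt1 reg.
have rphi a' : rational_on a a' (fun w => \sum_i z w i ^+ 2).
  by apply: rational_on_sum => i; apply: rational_onM; exact: rational_on_secular_pt.
have [v /andP[av vM] phiv] : exists2 v, a <= v <= M & 1 - \sum_i z v i ^+ 2 = 0.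
  apply: (@rational_on_ivt R a M (fun v => 1 - \sum_i z v i ^+ 2)) => //; last 2 first.
  - by rewrite subr_le0.
  - by rewrite subr_ge0 ltW.
  have [p [r pr]] := rational_onD (rational_on_poly a M 1%:P)
    (rational_onM (rational_on_poly a M (-1)%:P) (rphi M)).
  by exists p, r => w /pr; rewrite !hornerE mulN1r.
have qv : 0 <= q v 1 (z v).
  by apply: diag_form_sphere; apply/eqP; rewrite eq_sym -subr_eq0 phiv.
have [w /andP[aw wv] qw] : exists2 w, a <= w <= v & c - w - \sum_i b i * z w i = 0.
  apply: (@rational_on_ivt R a v (fun w => c - w - \sum_i b i * z w i)) => //.
  - have rs : rational_on a v (fun w => \sum_i b i * z w i).
      apply: rational_on_sum => i.
      have [p [r pr]] := rational_onM (rational_on_poly a v (b i)%:P)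
        (rational_on_secular_pt v i reg).
      by exists p, r => w /pr; rewrite hornerE.
    have [p [r pr]] := rational_onD (rational_on_poly a v (c%:P - 'X))
      (rational_onM (rational_on_poly a v (-1)%:P) rs).
    by exists p, r => w /pr; rewrite !hornerE mulN1r.
  - by rewrite -diag_form_secular_val.
  - by rewrite -diag_form_secular_val//; exact: secular_domW reg av.
have regw := secular_domW reg aw.
exists w; rewrite ?diag_form_secular_val//; split=> //.
have := secular_norm_anti regw wv.
by move/eqP: phiv; rewrite subr_eq0 => /eqP <-.
Qed.

End SecularEquation.

(* The sphere condition is the trust-region problem of minimising a quadratic
   function; its Lagrange multiplier gives a [w] for which the form is positive
   semidefinite. *)
Lemma diag_form_isotropic (R : rcfType) n (c : R) (b d : 'I_n.+1 -> R) :
  (forall y : 'I_n.+1 -> R, \sum_i y i ^+ 2 = 1 ->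
    0 <= c - 2 * (\sum_i b i * y i) - \sum_i d i * y i ^+ 2) ->
  exists w, (forall s y, 0 <= diag_form c b d w s y) /\
    exists s y, [/\ diag_form c b d w s y = 0, s ^+ 2 <= \sum_i y i ^+ 2
                 & 0 < \sum_i y i ^+ 2].
Proof.
move=> sphere; pose q := diag_form c b d.
have [k _ kmax] := @arg_maxP _ R _ ord0 xpredT d isT.
pose D := d k; pose z := secular_pt b d.
pose reg := secular_dom b d.
have dD i : d i <= D by apply: kmax.
(* Either the end point [D] itself works, or there is a point [a] from which the root search can
   start. *)
suff [[regD qD]|[a rega [phia qa]]] :
    (reg D /\ 0 <= q D 1 (z D)) \/
    (exists2 a, reg a & 1 <= \sum_i z a i ^+ 2 /\ q a 1 (z a) <= 0).
- exists D; split; first exact: diag_form_psd.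
  (* The basis vector of a largest eigenvalue is isotropic, its coefficient [D - d k] being zero. *)
  exists 0, (fun i => (i == k)%:R); rewrite /diag_form.
  have e F : \sum_i F i * (i == k)%:R = F k :> R.
    rewrite (bigD1 k)//= eqxx mulr1 big1 ?addr0// => i /negbTE ->.
    by rewrite mulr0.
  have e2 : \sum_i (i == k)%:R ^+ 2 = 1 :> R.
    under eq_bigr do rewrite expr2; by rewrite e eqxx.
  have e3 F : \sum_i F i * (i == k)%:R ^+ 2 = F k :> R.
    by rewrite -e; apply: eq_bigr => i _; case: (i == k); rewrite ?expr1n// expr0n.
  rewrite e3 e2 expr0n/= subrr; split; [ring|exact: ler01|exact: ltr01].
- have [w regw [qw phiw]] := secular_root sphere rega phia qa.
  exists w; split; first by apply: diag_form_psd => //; rewrite qw.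
  by exists 1, (z w); rewrite expr1n; split=> //; apply: lt_le_trans phiw.
have [/forallP regD|/forallPn notreg] := boolP [forall i, (d i == D) ==> (b i == 0)].
  have {}regD : reg D.
    move=> i; split=> // bi; rewrite lt_neqAle dD andbT.
    by apply: contra bi => di; have /implyP/(_ di) := regD i.
  have [qD|qD] := leP 0 (q D 1 (z D)); first by left.
  right; exists D => //; split; last exact: ltW.
  rewrite leNgt; apply/negP => phi1; move: qD; apply/negP; rewrite -leNgt.
  have bk : b k = 0 by apply/eqP; apply/negP => /negP/(regD k).2; rewrite ltxx.
  have zk : z D k = 0 by rewrite /z /secular_pt bk mul0r.
  (* If [|z(D)| < 1], the free coordinate [k] can be filled up to reach the unit sphere. Its
     coefficient is zero, so the form keeps its value at [z(D)], which is then nonnegative. *)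
  pose tau := Num.sqrt (1 - \sum_i z D i ^+ 2).
  have tau2 : tau ^+ 2 = 1 - \sum_i z D i ^+ 2 by rewrite sqr_sqrtr// subr_ge0 ltW.
  pose y i := if i == k then tau else z D i.
  have y1 : \sum_i y i ^+ 2 = 1.
    have e1 : \sum_i z D i ^+ 2 = \sum_(i | i != k) z D i ^+ 2.
      by rewrite (bigD1 k)//= zk expr0n add0r.
    have e2 : \sum_(i | i != k) y i ^+ 2 = \sum_(i | i != k) z D i ^+ 2.
      by apply: eq_bigr => i /negbTE ik; rewrite /y ik.
    by rewrite (bigD1 k)//= {1}/y eqxx tau2 e1 e2 subrK.
  have := diag_form_sphere sphere D y1.
  rewrite diag_form_secular// expr1n mulr1 big1 ?addr0// => i _.
  by rewrite mul1r /y; case: eqP => [->|_]; rewrite subrr ?mul0r// expr0n mulr0.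
have [l] := notreg; rewrite negb_imply => /andP[/eqP di bi]; right.
(* Just above a pole: with [e = b l ^+ 2 / K] one has [z l = K / b l] and [b l * z l = K]. So
   [K >= |b l|] gives [|z| >= 1], and [K >= |c - D|] makes the secular function nonpositive. *)
pose K := 2 * `|b l| + `|c - D| + 1.
have b0 : 0 < `|b l| by rewrite normr_gt0.
have K0 : 0 < K by rewrite /K ltr_wpDl// addr_ge0// mulr_ge0.
pose e := b l ^+ 2 / K.
have e0 : 0 < e by rewrite divr_gt0// exprn_even_gt0.
have rega : reg (D + e).
  move=> j; have dj : d j < D + e by rewrite ltr_pwDr.
  by split=> //; exact: ltW.
have zi : z (D + e) l = K / b l.
  rewrite /z /secular_pt di (addrC D) addrK /e; field; by rewrite bi gt_eqF.
exists (D + e) => //; split.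
  rewrite (bigD1 l)//= zi -[1]addr0 lerD//; last by apply: sumr_ge0 => j _; exact: sqr_ge0.
  rewrite exprMn exprVn lter_pdivlMr ?exprn_even_gt0// mul1r -(real_normK (num_real (b l))).
  rewrite ler_sqr ?nnegrE ?ltW// /K.
  have := normr_ge0 (c - D); lra.
have -> : q (D + e) 1 (z (D + e)) = c - (D + e) - \sum_j b j * z (D + e) j.
  exact: diag_form_secular_val.
rewrite (bigD1 l)//= zi mulrC mulfVK//.
have s0 : 0 <= \sum_(j | j != l) b j * z (D + e) j.
  apply: sumr_ge0 => j _; rewrite /z /secular_pt mulrA -expr2 mulr_ge0 ?sqr_ge0//.
  by rewrite invr_ge0 subr_ge0; have [] := rega j.
have := ler_norm (c - D); rewrite /K; lra.
Qed.

(** * Semidefinite forms and Minkowski geometry *)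

Section SemidefiniteForm.
Variables (R : rcfType) (n : nat) (Q : 'M[R]_n).
Hypotheses (symQ : Q^T = Q) (psdQ : forall v, 0 <= cdot v (Q *m v)).

Lemma cdot_symmetric u v : cdot u (Q *m v) = cdot v (Q *m u).
Proof. by rewrite cdotC cdot_mulmxl symQ. Qed.

Lemma psd_formD u v :
  cdot (u + v) (Q *m (u + v)) =
  cdot u (Q *m u) + 2 * cdot u (Q *m v) + cdot v (Q *m v).
Proof.
by rewrite mulmxDr cdotDl !cdotDr (cdot_symmetric v u); ring.
Qed.

Lemma psd_formZ a u : cdot (a *: u) (Q *m (a *: u)) = a ^+ 2 * cdot u (Q *m u).
Proof. by rewrite -scalemxAr cdotZl cdotZr; ring. Qed.

Lemma psd_cauchy u v :
  cdot u (Q *m v) ^+ 2 <= cdot u (Q *m u) * cdot v (Q *m v).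
Proof.
have expand (a b : R) : 0 <= a ^+ 2 * cdot u (Q *m u) + 2 * (a * b) * cdot u (Q *m v)
    + b ^+ 2 * cdot v (Q *m v).
  have := psdQ (a *: u + b *: v); rewrite psd_formD !psd_formZ.
  by rewrite -scalemxAr cdotZl cdotZr !mulrA.
move: (psdQ u) (psdQ v) expand.
set p := cdot u (Q *m u); set r := cdot v (Q *m v); set s := cdot u (Q *m v).
(* For [r > 0] the coefficients [(r, -s)] produce [r (p r - s^2)]. *)
move=> p0 r0 expand; have [r1|r1] := ltP 0 r.
  have := expand r (- s); have -> : r ^+ 2 * p + 2 * (r * - s) * s + (- s) ^+ 2 * r =
    r * (p * r - s ^+ 2) by ring.
  by rewrite pmulr_rge0// subr_ge0.
have {r0 r1} r0 : r = 0 by apply/le_anti; rewrite r0 r1.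
rewrite r0 mulr0; have [->|s0] := eqVneq s 0; first by rewrite expr0n.
(* For [r = 0] these coefficients produce [s^2 (-p - 2)], negative unless [s = 0]. *)
have := expand s (- (p + 1)); rewrite r0.
have -> : s ^+ 2 * p + 2 * (s * - (p + 1)) * s + (- (p + 1)) ^+ 2 * 0 =
    s ^+ 2 * (- p - 2) by ring.
rewrite pmulr_rge0 ?exprn_even_gt0// => h; lra.
Qed.

(** Cauchy-Schwarz for the pair [Q u], [u] bounds [|Q u|^4] by zero. *)
Lemma psd_isotropic_ker u : cdot u (Q *m u) = 0 -> Q *m u = 0.
Proof.
move=> u0; have := psd_cauchy (Q *m u) u; rewrite u0 mulr0 => h.
apply/eqP; rewrite -cdot_eq0 -sqrf_eq0; apply/eqP/le_anti.
by rewrite h sqr_ge0.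
Qed.

Lemma psd_formD_ker u k : Q *m k = 0 -> cdot (u + k) (Q *m (u + k)) = cdot u (Q *m u).
Proof.
by move=> k0; rewrite psd_formD k0 !cdot0r mulr0 !addr0.
Qed.

Lemma psd_sqrt_triangle u v :
  Num.sqrt (cdot (u + v) (Q *m (u + v))) <=
  Num.sqrt (cdot u (Q *m u)) + Num.sqrt (cdot v (Q *m v)).
Proof.
have := psd_cauchy u v; rewrite psd_formD.
move: (psdQ u) (psdQ v).
set p := cdot u _; set r := cdot v _; set s := cdot u _ => p0 r0 cs.
have ps : Num.sqrt p ^+ 2 = p by rewrite sqr_sqrtr.
have rs : Num.sqrt r ^+ 2 = r by rewrite sqr_sqrtr.
have pg := sqrtr_ge0 p; have rg := sqrtr_ge0 r.
rewrite -[leRHS]ger0_norm ?addr_ge0// -sqrtr_sqr ler_wsqrtr// sqrrD ps rs.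
have : s <= Num.sqrt p * Num.sqrt r.
  rewrite (le_trans (ler_norm s))// -ler_sqr ?nnegrE ?mulr_ge0//.
  by rewrite real_normK ?num_real// exprMn ps rs.
move=> h; rewrite -mulr_natr; lra.
Qed.

Lemma psd_sqrtZ a u : 0 <= a ->
  Num.sqrt (cdot (a *: u) (Q *m (a *: u))) = a * Num.sqrt (cdot u (Q *m u)).
Proof. by move=> a0; rewrite psd_formZ sqrtrM ?sqr_ge0// sqrtr_sqr ger0_norm. Qed.

Lemma psd_sqrt_sum m (v : 'I_m -> 'cV[R]_n) :
  Num.sqrt (cdot (\sum_i v i) (Q *m \sum_i v i)) <=
  \sum_i Num.sqrt (cdot (v i) (Q *m v i)).
Proof.
elim: m v => [|m IHm] v.
  by rewrite !big_ord0 mulmx0 cdot0r sqrtr0.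
rewrite !big_ord_recr/=; apply: le_trans (psd_sqrt_triangle _ _) _.
by rewrite lerD2r.
Qed.

End SemidefiniteForm.

Lemma cdot_cauchy (R : rcfType) n (u v : 'cV[R]_n) :
  cdot u v ^+ 2 <= cdot u u * cdot v v.
Proof.
have := @psd_cauchy R n 1%:M (trmx1 _ _).
rewrite -{1}[u]mul1mx => /(_ _ u v); rewrite !mul1mx; apply=> x.
by rewrite mul1mx cdot_ge0.
Qed.

(** * Minkowski vectors and the light cone *)

Definition mk_mvec {R : rcfType} (s : R) (v : 'cV[R]_3) : mvec R := col_mx s%:M v.

Section Minkowski.
Variable R : rcfType.
Implicit Types (x y : mvec R) (s : R) (v : 'cV[R]_3).

Lemma x0_mk s v : x0 (mk_mvec s v) = s.
Proof. by rewrite /x0 col_mxKu mxE. Qed.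

Lemma xv_mk s v : xv (mk_mvec s v) = v.
Proof. by rewrite /xv col_mxKd. Qed.

Lemma mvecK x : mk_mvec (x0 x) (xv x) = x.
Proof. by rewrite /mk_mvec /x0 -mx11_scalar vsubmxK. Qed.

Lemma x0D x y : x0 (x + y) = x0 x + x0 y.
Proof. by rewrite /x0 linearD mxE. Qed.

Lemma x0Z s x : x0 (s *: x) = s * x0 x.
Proof. by rewrite /x0 linearZ mxE. Qed.

Lemma xvD x y : xv (x + y) = xv x + xv y.
Proof. by rewrite /xv linearD. Qed.

Lemma xvZ s x : xv (s *: x) = s *: xv x.
Proof. by rewrite /xv linearZ. Qed.

Lemma cdot_mk s v s' v' : cdot (mk_mvec s v) (mk_mvec s' v') = s * s' + cdot v v'.
Proof.
rewrite /cdot /mk_mvec tr_col_mx mul_row_col mxE; congr (_ + _).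
by rewrite tr_scalar_mx mul_scalar_mx !mxE.
Qed.

Lemma mdotE x y : mdot x y = x0 x * x0 y - cdot (xv x) (xv y).
Proof.
rewrite /mdot -[x in LHS]mvecK -[y in LHS]mvecK -mulmxA -[LHS]/(cdot _ _).
rewrite /minkJ /mk_mvec mul_block_col -!idmxE mul1mx !mul0mx add0r addr0 mulNmx mul1mx.
by rewrite -!/(mk_mvec _ _) cdot_mk -scaleN1r cdotZr mulN1r.
Qed.

Lemma mdotC x y : mdot x y = mdot y x.
Proof. by rewrite !mdotE cdotC mulrC. Qed.

Lemma mdotDr x y y' : mdot x (y + y') = mdot x y + mdot x y'.
Proof. by rewrite !mdotE x0D xvD cdotDr; ring. Qed.

Lemma mdotZr s x y : mdot x (s *: y) = s * mdot x y.
Proof. by rewrite !mdotE x0Z xvZ cdotZr; ring. Qed.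

Lemma mdot_comb s s' x y : mdot (s *: x + s' *: y) (s *: x + s' *: y) =
  s ^+ 2 * mdot x x + 2 * (s * s') * mdot x y + s' ^+ 2 * mdot y y.
Proof.
rewrite mdotDr !mdotZr !(mdotC _ x) !(mdotC _ y) !mdotDr !mdotZr (mdotC y x); ring.
Qed.

(** If [x0 y <= 0], Cauchy-Schwarz on the spatial parts gives [- xv x . xv y <= - x0 x * x0 y], so
    the product is at most zero. *)
Lemma mdot_gt0_future x y :
  0 <= x0 x -> 0 <= mdot x x -> 0 <= mdot y y -> 0 < mdot x y -> 0 < x0 y.
Proof.
rewrite !mdotE => x_ge xx yy; apply: contraTT; rewrite -!leNgt => y_le.
have cs := cdot_cauchy (xv x) (xv y).
have := cdot_ge0 (xv x); have := cdot_ge0 (xv y).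
move: cs xx yy; set p := cdot _ _; set q := cdot (xv x) (xv x); set r := cdot (xv y) _.
move=> cs xx yy r0 q0.
have : p ^+ 2 <= (x0 x * - x0 y) ^+ 2.
  apply: le_trans cs _; rewrite exprMn sqrrN ler_pM//; first by rewrite expr2; lra.
  by rewrite expr2; lra.
rewrite -ler_sqrt ?sqr_ge0// !sqrtr_sqr [leRHS]ger0_norm ?mulr_ge0 ?oppr_ge0// => h.
have := ler_norm (- p); rewrite normrN; lra.
Qed.

(* Reversed Cauchy-Schwarz: the plane spanned by [x] and [y] is Lorentzian. *)
Lemma mdot_disc_gt0 x y : 0 < mdot x x -> mdot y y <= 0 -> y != 0 ->
  0 < mdot x y ^+ 2 - mdot x x * mdot y y.
Proof.
move=> xx yy y0; have [yy0|yy0] := ltP (mdot y y) 0.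
  by rewrite subr_gt0 (lt_le_trans _ (sqr_ge0 _))// pmulr_rlt0.
have {yy yy0} yy : mdot y y = 0 by apply/le_anti; rewrite yy.
rewrite yy mulr0 subr0 exprn_even_gt0//=; apply: contra_neq y0 => xy.
move: xx yy xy; rewrite !mdotE => xx yy xy.
have := cdot_cauchy (xv x) (xv y); have := cdot_ge0 (xv y).
have -> : cdot (xv x) (xv y) = x0 x * x0 y by lra.
have yv : cdot (xv y) (xv y) = x0 y * x0 y by lra.
rewrite yv => y_ge h.
(* Cauchy-Schwarz has become [mdot x x * x0 y ^+ 2 <= 0]. *)
have y00 : x0 y = 0.
  apply/eqP; rewrite -sqrf_eq0; apply/eqP/le_anti; rewrite sqr_ge0 andbT expr2.
  rewrite -(pmulr_rle0 _ xx); nra.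
move/eqP: yv; rewrite y00 mulr0 cdot_eq0 => /eqP yv.
rewrite -(mvecK y) y00 yv /mk_mvec (_ : 0%:M = 0) ?col_mx0//.
by apply/matrixP => i j; rewrite !mxE mul0rn.
Qed.

(* The line [x + R n] meets the light cone on both sides of [x]; a lightlike
   [n] is itself the direction of one of the two null summands. *)
Lemma null_splitting x n : 0 <= x0 x -> 0 < mdot x x -> mdot n n <= 0 -> n != 0 ->
  exists al be ga : R, [/\ 0 <= al, 0 <= be & al + be = 1] /\
    (forall a, (a = al *: x + ga *: n \/ a = be *: x + (- ga) *: n) ->
       mdot a a = 0 /\ 0 < x0 a).
Proof.
move=> x_ge xx nn n0; have disc := mdot_disc_gt0 xx nn n0.
pose D := Num.sqrt (mdot x n ^+ 2 - mdot x x * mdot n n).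
have D0 : 0 < D by rewrite sqrtr_gt0.
have D2 : D ^+ 2 = mdot x n ^+ 2 - mdot x x * mdot n n by rewrite sqr_sqrtr// ltW.
have BD : `|mdot x n| <= D.
  rewrite -sqrtr_sqr ler_wsqrtr// lerDl oppr_ge0; exact: mulr_ge0_le0 (ltW xx) nn.
have Bp : 0 <= D + mdot x n by have := ler_norm (- mdot x n); rewrite normrN; lra.
have Bm : 0 <= D - mdot x n by have := ler_norm (mdot x n); lra.
have Dn0 : D != 0 by rewrite gt_eqF.
have D20 : 0 < 2 * D by rewrite mulr_gt0.
(* With [B = mdot x n], the roots of [mdot (x + r n) (x + r n)] in [r] are [- mdot x x / (B + D)]
   and [- mdot x x / (B - D)]. This form avoids dividing by [mdot n n], which may be zero; weights
   proportional to [D + B] and [D - B] make the [n] parts cancel. *)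
exists ((D + mdot x n) / (2 * D)), ((D - mdot x n) / (2 * D)), (- mdot x x / (2 * D)).
split; first by split; [rewrite divr_ge0// ltW|rewrite divr_ge0// ltW|field].
have null e : (e = 1 \/ e = -1) ->
    forall a, a = ((D + e * mdot x n) / (2 * D)) *: x + (- e * mdot x x / (2 * D)) *: n ->
    mdot a a = 0 /\ 0 < x0 a.
  move=> e1 a ->; have e2 : e ^+ 2 = 1 by case: e1 => ->; rewrite ?sqrrN expr1n.
  set a' := _ + _.
  have aa : mdot a' a' = 0.
    rewrite /a' mdot_comb; have -> : mdot n n = (mdot x n ^+ 2 - D ^+ 2) / mdot x x.
      by rewrite D2; field; rewrite gt_eqF.
    transitivity ((1 - e ^+ 2) * mdot x x / 4); last by rewrite e2; ring.
    field; by rewrite Dn0 gt_eqF.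
  (* Each summand has Minkowski product [mdot x x / 2] with [x], so it points to the future. *)
  split=> //; apply: (mdot_gt0_future x_ge (ltW xx)); first by rewrite aa.
  rewrite mdotDr !mdotZr.
  suff -> : (D + e * mdot x n) / (2 * D) * mdot x x +
    - e * mdot x x / (2 * D) * mdot x n = mdot x x / 2 by rewrite divr_gt0.
  by field.
move=> a [] ->; [apply: (null 1)|apply: (null (-1))]; try by [left|right].
  by rewrite mul1r mulN1r.
by rewrite !mulN1r opprK mul1r mulNr opprK.
Qed.

End Minkowski.

(** * The concurrence *)

Section Concurrence.
Variables (R : rcfType) (L : 'M[R]_3) (t : 'cV[R]_3).
Implicit Types (w : R) (x : mvec R).

(** * The quadratic form in coordinates, and the number [w0] *)

Lemma qformE w x : qform L t w x =
  (1 - cdot t t - w) * x0 x ^+ 2 - 2 * x0 x * cdot t (L *m xv x)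
  + (w * cdot (xv x) (xv x) - cdot (L *m xv x) (L *m xv x)).
Proof.
have P0 : x0 (Phi L t x) = x0 x by rewrite /x0 col_mxKu.
have Pv : xv (Phi L t x) = x0 x *: t + L *m xv x by rewrite /xv col_mxKd.
rewrite /qform !mdotE P0 Pv !cdotDl !cdotDr !cdotZl !cdotZr (cdotC (L *m _) t).
ring.
Qed.

Lemma Qmat_sym w : (Qmat L t w)^T = Qmat L t w.
Proof.
rewrite /Qmat tr_block_mx tr_scalar_mx !linearN/= trmxK; congr block_mx.
by rewrite linearB/= tr_scalar_mx trmx_mul trmxK.
Qed.

Lemma qform_Qmat w x : qform L t w x = cdot x (Qmat L t w *m x).
Proof.
rewrite qformE -[x in RHS]mvecK /Qmat /mk_mvec mul_block_col.
have -> : (1 - (t^T *m t) ord0 ord0 - w)%:M *m (x0 x)%:M + - (t^T *m L) *m xv x =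
    ((1 - cdot t t - w) * x0 x - cdot t (L *m xv x))%:M.
  rewrite mul_scalar_mx mulNmx -mulmxA [t^T *m (L *m _)]mx11_scalar.
  rewrite -/(cdot t (L *m xv x)) -/(cdot t t).
  move: (cdot t t) (cdot t _) => a b.
  by apply/matrixP => i j; rewrite !ord1 !mxE eqxx !mulr1n.
rewrite -/(mk_mvec _ _) -/(mk_mvec _ _) cdot_mk.
rewrite mul_mx_scalar mulmxBl mul_scalar_mx cdotDr cdotZr cdotDr -scaleN1r cdotZr.
rewrite -[- (_ *m _ *m _)]scaleN1r cdotZr cdotZr.
rewrite trmx_mul trmxK -!mulmxA -!cdot_mulmxl (cdotC _ t).
ring.
Qed.

Lemma qform_diag (O : 'M[R]_3) (d : 'rV[R]_3) w (s : R) (y : 'cV[R]_3) :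
  O^T *m O = 1%:M -> O^T *m (L^T *m L) *m O = diag_mx d ->
  qform L t w (mk_mvec s (O *m y)) =
  diag_form (1 - cdot t t) (fun i => (O^T *m (L^T *m t)) i 0) (d 0) w s (y ^~ 0).
Proof.
move=> OO OLO; rewrite qformE x0_mk xv_mk /diag_form.
have -> : cdot (L *m (O *m y)) (L *m (O *m y)) = \sum_i d 0 i * y i 0 ^+ 2.
  rewrite !cdot_mulmxl !mulmxA -(mulmxA O^T) OLO cdotE.
  by apply: eq_bigr => i _; rewrite mul_diag_mx mxE; ring.
have -> : cdot (O *m y) (O *m y) = \sum_i y i 0 ^+ 2.
  by rewrite cdot_mulmxl mulmxA OO mul1mx cdot_sqr.
have -> : cdot t (L *m (O *m y)) = \sum_i (O^T *m (L^T *m t)) i 0 * y i 0.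
  by rewrite cdotC !cdot_mulmxl cdotC cdotE.
congr (_ + _); rewrite mulr_sumr -sumrB; apply: eq_bigr => i _; ring.
Qed.

Lemma good_w_exists : positive_map L t -> exists w, good_w L t w.
Proof.
move=> pos; have symA : (L^T *m L)^T = L^T *m L by rewrite trmx_mul trmxK.
have [O [d [OO OLO]]] := symmetric_diagonalization symA.
have mdot_mk (s : R) (y : 'cV[R]_3) :
    mdot (mk_mvec s (O *m y)) (mk_mvec s (O *m y)) = s ^+ 2 - \sum_i y i 0 ^+ 2.
  by rewrite mdotE x0_mk xv_mk cdot_mulmxl mulmxA OO mul1mx cdot_sqr.
have := @diag_form_isotropic R 2 (1 - cdot t t) (fun i => (O^T *m (L^T *m t)) i 0) (d 0).
case=> [y y1|w [psd [s [y [qn mn n0]]]]].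
  (* Points of the unit sphere correspond to pure states, for which positivity of [Phi] is the
     required inequality. *)
  pose x := mk_mvec 1 (O *m \col_i y i).
  have xx : mdot x x = 0.
    rewrite mdot_mk expr1n -[X in X - _]y1; apply/eqP; rewrite subr_eq0.
    by apply/eqP/eq_bigr => i _; rewrite mxE.
  have [|_] := pos x; first by rewrite /psd_herm xx x0_mk; split.
  have -> : mdot (Phi L t x) (Phi L t x) = qform L t 0 x by rewrite /qform mul0r subr0.
  rewrite /x (qform_diag _ _ _ OO OLO) /diag_form subr0 expr1n !mulr1.
  rewrite (eq_bigr (fun i => (O^T *m (L^T *m t)) i 0 * y i)); last first.
    by move=> i _; rewrite [(\col__ _) _ _]mxE.
  rewrite [X in _ + X](eq_bigr (fun i => - (d 0 i * y i ^+ 2))); last first.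
    by move=> i _; rewrite [(\col__ _) _ _]mxE sub0r mulNr.
  by rewrite sumrN.
have psdQ x : 0 <= cdot x (Qmat L t w *m x).
  rewrite -qform_Qmat -(mvecK x) -[xv x]mul1mx -(mulmx1C OO) -mulmxA.
  by rewrite (qform_diag _ _ _ OO OLO).
pose n := mk_mvec s (O *m \col_i y i).
have nE : mdot n n = s ^+ 2 - \sum_i y i ^+ 2.
  by rewrite mdot_mk; congr (_ - _); apply: eq_bigr => i _; rewrite mxE.
have nn : mdot n n <= 0 by rewrite nE subr_le0.
have Qn : Qmat L t w *m n = 0.
  apply: psd_isotropic_ker => //; first exact: Qmat_sym.
  rewrite -qform_Qmat (qform_diag _ _ _ OO OLO) -[RHS]qn /diag_form.
  by congr (_ - _ * _ + _); apply: eq_bigr => i _; rewrite [(\col__ _) _ _]mxE.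
have n_neq0 : n != 0.
  apply/eqP => n00; move: n0; apply/negP; rewrite -leNgt.
  have s0 : s = 0 by rewrite -(x0_mk s (O *m \col_i y i)) -/n n00 /x0 linear0 mxE.
  move: nE; rewrite n00 mdotE /x0 linear0 /xv linear0 cdot0r.
  by rewrite mxE s0 mulr0 expr0n subrr sub0r => /esym/eqP; rewrite oppr_eq0 => /eqP ->.
exists w; split; first by move=> v; rewrite -mulmxA; exact: psdQ.
split; last by exists n.
apply/eqP/det0P; exists n^T; first by rewrite trmx_eq0.
by rewrite -(Qmat_sym w) -trmx_mul Qn trmx0.
Qed.

Lemma good_wP w : good_w L t w ->
  (forall v, 0 <= cdot v (Qmat L t w *m v)) /\
  exists n : mvec R, [/\ n != 0, Qmat L t w *m n = 0 & mdot n n <= 0].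
Proof.
move=> [psd [_ [n [n0 [Qn nn]]]]]; split; last by exists n.
by move=> v; have := psd v; rewrite -mulmxA.
Qed.

Lemma qform_shift w w' x : qform L t w x = qform L t w' x + (w' - w) * mdot x x.
Proof. rewrite /qform; ring. Qed.

(* Subtracting [Q_w n = 0] from [Q_w' n = 0] gives [(w' - w) J n = 0]. *)
Lemma good_w_unique w w' : good_w L t w -> good_w L t w' -> w = w'.
Proof.
wlog ww : w w' / w < w' => [hw gw gw'|].
  by have [/hw->|/hw <-|] := ltgtP w w'.
move=> /good_wP[psd _] /good_wP[_ [n [n0 Qn nn]]].
have qn : qform L t w' n = 0 by rewrite qform_Qmat Qn cdot0r.
(* Here [q_w(n) = (w' - w) n.n <= 0], so [n] also lies in the kernel of [Q_w]. *)
have qn' : cdot n (Qmat L t w *m n) = 0.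
  apply/le_anti; rewrite psd andbT -qform_Qmat (qform_shift w w') qn add0r.
  by rewrite pmulr_rle0// subr_gt0.
have {}Qn' := psd_isotropic_ker (Qmat_sym w) psd qn'.
(* Both forms are invariant under translation by [n], hence so is their difference
   [(w' - w) y.y]. *)
have mk y : mdot n y = 0.
  have qy v : Qmat L t v *m n = 0 -> qform L t v (n + y) = qform L t v y.
    by move=> Qv; rewrite addrC !qform_Qmat psd_formD_ker//; exact: Qmat_sym.
  have q0 v : Qmat L t v *m n = 0 -> qform L t v n = 0.
    by move=> Qv; rewrite qform_Qmat Qv cdot0r.
  have := qform_shift w w' (n + y); have := qform_shift w w' y.
  have := qform_shift w w' n; rewrite !qy// !q0//.
  have -> : mdot (n + y) (n + y) = mdot n n + 2 * mdot n y + mdot y y.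
    by have := mdot_comb 1 1 n y; rewrite !scale1r expr1n !mulr1 !mul1r.
  move=> h1 h2 h3; have: (w' - w) * mdot n y = 0 by lra.
  by move/eqP; rewrite mulf_eq0 subr_eq0 gt_eqF//= => /eqP.
(* Pairing [n] with its spatial reflection gives its Euclidean norm. *)
case/eqP: n0; have := mk (mk_mvec (x0 n) (- xv n)).
rewrite mdotE x0_mk xv_mk -scaleN1r cdotZr mulN1r opprK -cdot_mk mvecK.
by move/eqP; rewrite cdot_eq0 => /eqP.
Qed.

(** * Lower bound and optimal decompositions *)

Lemma conc_pureE w x : mdot x x = 0 -> conc_pure L t x = Num.sqrt (qform L t w x).
Proof.
move=> xx; rewrite /conc_pure /det_of /qform xx mulr0 subr0 mulrC.
have [h|h] := leP 0 (mdot (Phi L t x) (Phi L t x)).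
  rewrite sqrtrM//; have -> : 4%:R^-1 = (2%:R^-1) ^+ 2 :> R by field.
  by rewrite sqrtr_sqr ger0_norm ?invr_ge0 ?ler0n// -mulrA mulVf ?mulr1// pnatr_eq0.
(* For a negative argument both square roots are zero by convention. *)
by rewrite !ler0_sqrtr ?mul0r// ?ltW// pmulr_llt0// invr_gt0 ltr0n.
Qed.

Lemma concurrence_ge w x n (p : 'I_n -> R) (pi : 'I_n -> mvec R) :
  good_w L t w -> pure_decomp x p pi ->
  Num.sqrt (qform L t w x) <= decomp_value L t p pi.
Proof.
move=> /good_wP[psd _] [p0 [_ [pure <-]]].
rewrite qform_Qmat; apply: le_trans (psd_sqrt_sum (Qmat_sym w) psd _) _.
apply: ler_sum => j _; rewrite psd_sqrtZ; [rewrite -qform_Qmat|exact: ltW].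
by have [_ pj] := pure j; rewrite (conc_pureE w pj).
Qed.

(** Dividing each null summand by its trace [x0] gives a pure state with that trace as weight;
    [sqrt q_w] is homogeneous, so the weight is absorbed again in the value. *)
Lemma concurrence_split w x (a b : mvec R) : x = a + b -> x0 x = 1 ->
  (forall v, 0 <= cdot v (Qmat L t w *m v)) ->
  mdot a a = 0 -> mdot b b = 0 -> 0 < x0 a -> 0 < x0 b ->
  exists n (p : 'I_n -> R) pi, pure_decomp x p pi /\
    decomp_value L t p pi = Num.sqrt (qform L t w a) + Num.sqrt (qform L t w b).
Proof.
move=> xE x1 psd aa bb a0 b0.
pose v (j : 'I_2) : mvec R := if j == ord0 then a else b.
have vv j : mdot (v j) (v j) = 0 by rewrite /v; case: ifP.
have v0 j : 0 < x0 (v j) by rewrite /v; case: ifP.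
have vK j : x0 (v j) *: ((x0 (v j))^-1 *: v j) = v j.
  by rewrite scalerA mulfV ?scale1r// gt_eqF.
have sum2 (V : nmodType) (F : mvec R -> V) : \sum_j F (v j) = F a + F b.
  by rewrite !big_ord_recl big_ord0 addr0.
have pp j : mdot ((x0 (v j))^-1 *: v j) ((x0 (v j))^-1 *: v j) = 0.
  by rewrite mdotZr mdotC mdotZr vv !mulr0.
exists 2, (fun j => x0 (v j)), (fun j => (x0 (v j))^-1 *: v j); split.
  split=> //; split; first by rewrite (sum2 _ x0) -x0D -xE.
  split=> [j|]; last by rewrite (eq_bigr v)// (sum2 _ id).
  by rewrite /is_pure /is_state /psd_herm pp x0Z mulVf ?gt_eqF.
rewrite /decomp_value -(sum2 _ (fun u => Num.sqrt (qform L t w u))).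
apply: eq_bigr => j _; rewrite (conc_pureE w (pp j)) !qform_Qmat.
by rewrite -psd_sqrtZ ?vK// ltW.
Qed.

Lemma concurrence_attained w x : good_w L t w -> is_state x ->
  exists n (p : 'I_n -> R) pi, pure_decomp x p pi /\
    decomp_value L t p pi = Num.sqrt (qform L t w x).
Proof.
move=> /good_wP[psd [n [n0 Qn nn]]] st; have [[x_ge xx] x1] := st.
have [xx0|xx0] := eqVneq (mdot x x) 0.
  exists 1, (fun=> 1), (fun=> x); rewrite /pure_decomp /decomp_value !big_ord_recl !big_ord0.
  by rewrite !addr0 scale1r mul1r (conc_pureE w xx0); split.
have {xx0} xx0 : 0 < mdot x x by rewrite lt_def xx0.
have [al [be [ga [[al0 be0 ab1] null]]]] := null_splitting x_ge xx0 nn n0.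
have [aa a0] := null _ (or_introl erefl); have [bb b0] := null _ (or_intror erefl).
have xE : x = (al *: x + ga *: n) + (be *: x + (- ga) *: n).
  by rewrite addrACA -!scalerDl ab1 subrr scale0r addr0 scale1r.
have [m [p [pi [dec val]]]] := concurrence_split xE x1 psd aa bb a0 b0.
exists m, p, pi; split=> //; rewrite val !qform_Qmat.
(* Shifts along the kernel vector [n] do not change the form, so the two values add up to
   [(al + be) sqrt q_w(x)]. *)
have sq c k : 0 <= c -> Num.sqrt (cdot (c *: x + k *: n) (Qmat L t w *m (c *: x + k *: n))) =
    c * Num.sqrt (cdot x (Qmat L t w *m x)).
  move=> c0; rewrite psd_formD_ker ?psd_sqrtZ//; first exact: Qmat_sym.
  by rewrite -scalemxAr Qn scaler0.
by rewrite !sq// -mulrDl ab1 mul1r.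
Qed.

End Concurrence.

Theorem theorem3 (R : rcfType) (L : 'M[R]_3) (t : 'cV[R]_3)
    (Hpos : positive_map L t) :
  (forall (w : R) (x : mvec R), qform L t w x = (x^T *m Qmat L t w *m x) ord0 ord0) /\
  exists w0 : R, good_w L t w0 /\ (forall w : R, good_w L t w -> w = w0) /\
    (forall x : mvec R, is_state x ->
       concurrence_is L t x (Num.sqrt (qform L t w0 x))).
Proof.
split=> [w x|]; first by rewrite qform_Qmat /cdot mulmxA.
have [w gw] := good_w_exists Hpos; exists w; split=> //; split.
  by move=> w' gw'; exact: good_w_unique gw' gw.
move=> x st; split; first exact: concurrence_attained gw st.
by move=> n p pi; exact: concurrence_ge gw.
Qed.
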